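(* For every $\mathtt{NI}^\bullet$-derivation $\mathscr D$, one has $\mathscr D^*\simeq_{\beta\eta\varepsilon}\mathscr D^{*\downarrow}$ and $\mathscr D^*\simeq_{\beta\eta\varepsilon}\mathscr D^\sharp$ (equivalences of $\mathtt{NI}^2$-derivations), where $\mathscr D^*$ is the RP-translation, $\mathscr D^{*\downarrow}$ the FF-translation and $\mathscr D^\sharp$ the ESF-translation of $\mathscr D$.
   Context: Derivations are written as typed $\lambda$-terms; type information is regarded as part of the term, though not displayed, and translations are defined by recursion on derivations. Formulas. $\mathcal L^\bullet$: $A::=X\mid A\supset B\mid\bullet(A,B,C)$. $\mathcal L^2$: $A::=X\mid A\supset B\mid\forall X.A$. $\mathtt{NI}^\bullet$ (over $\mathcal L^\bullet$) has the usual rules for assumptions and $\supset$ (terms $x,\lambda x.t,tu$), and for $\bullet$ (which behaves like $(A_1\wedge A_2)\vee A_3$): from $t_1:A_1$, $t_2:A_2$ infer $\iota^1(t_1,t_2):\bullet(A_1,A_2,A_3)$; from $t_3:A_3$ infer $\iota^2(t_3):\bullet(A_1,A_2,A_3)$; from $t:\bullet(A_1,A_2,A_3)$, from $s_1:C$ under additional assumptions $y_1:A_1,y_2:A_2$, and from $s_2:C$ under additional assumption $y_3:A_3$, infer $\delta(t,\,y_1y_2.s_1,\,y_3.s_2):C$ (discharging $y_1,y_2,y_3$). $\mathtt{NI}^2$ (over $\mathcal L^2$) is System F: terms $x,\lambda x.t,tu,\Lambda X.t,tB$, where $\Gamma\vdash t:A$ with $X\notin FV(\Gamma)$ gives $\Lambda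 X.t:\forall X.A$, and $t:\forall X.A$ gives $tB:A\llbracket B/X\rrbracket$. Equivalence $\simeq_{\beta\eta\varepsilon}$ on $\mathtt{NI}^2$: the least typed congruence (reflexive, symmetric, transitive) generated by $(\lambda x.t)s\simeq t\llbracket s/x\rrbracket$; $(\Lambda X.t)B\simeq t\llbracket B/X\rrbracket$; $t\simeq\lambda x.tx$ ($x\notin FV(t)$, $t$ of implication type); $t\simeq\Lambda X.tX$ ($X\notin FV(t)$, $t$ of universal type); and the rule $\varepsilon$: for a universal polynomial formula $\forall X.G_1\supset\dots\supset G_n\supset X$ with $G_k=A_{k1}\supset\dots\supset A_{km_k}\supset X$ and $X$ not free in the $A_{kj}$ ($n,m_k\ge0$), if $t$ has this type in typing context $\Gamma$, $\Gamma\vdash u_k:G_k\llbracket C/X\rrbracket$ for $1\le k\le n$, and $\mathtt U$ is a term context with $\Gamma,x:C\vdash\mathtt U[x]:D$, then $\mathtt U[t\,C\,u_1\cdots u_n]\simeq t\,D\,v_1\cdots v_n$ where $v_k=\lambda w_1\dots\lambda w_{m_k}.\mathtt U[u_kw_1\cdots w_{m_k}]$ with fresh $w$'s. A term context is a term with a hole $[\ ]$ (occurring any finite number of times); $\mathtt U[t]$ is capture-avoiding and $\mathtt U\{t\}$ is variable-capturing substitution for the hole. RP-translation. $X^*=X$, $(A\supset B)^*=A^*\supset B^*$, $\bullet(A_1,A_2,A_3)^*=\forall X.(A_1^*\supset A_2^*\supset X)\supset(A_3^*\supset X)\supset X$ ($X$ fresh). $x^*=x$, $(\lambda x.t)^*=\lambda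 x.t^*$, $(ts)^*=t^*s^*$, $(\iota^1(t_1,t_2))^*=\Lambda X.\lambda x_1.\lambda x_2.x_1t_1^*t_2^*$, $(\iota^2(t_3))^*=\Lambda X.\lambda x_1.\lambda x_2.x_2t_3^*$, and for a $\delta$-term of type $C$: $(\delta(t,y_1y_2.s_1,y_3.s_2))^*=t^*\,C^*\,(\lambda y_1.\lambda y_2.s_1^* )\,(\lambda y_3.s_2^* )$. FF-atomization and FF-translation. $(\cdot)^\downarrow$ is defined on derivations of the fragment of $\mathtt{NI}^2$ in which all universal formulas have the form $\forall X.(A\supset B\supset X)\supset(C\supset X)\supset X$ with $X$ not free in $A,B,C$ (this contains all $\mathscr D^*$). It commutes with variables, $\lambda$, application, $\Lambda$ and with $tY$ for $Y$ a variable, and for $t:\forall X.(A\supset B\supset X)\supset(C\supset X)\supset X$: $(t(F_1\supset F_2))^\downarrow=\lambda k_1.\lambda k_2.\lambda m.(tF_2)^\downarrow(\lambda a.\lambda b.k_1\,a\,b\,m)(\lambda c.k_2\,c\,m)$; $(t(\forall Z.F'))^\downarrow=\lambda k_1.\lambda k_2.\Lambda Z.(tF')^\downarrow(\lambda a.\lambda b.k_1\,a\,b\,Z)(\lambda c.k_2\,c\,Z)$. The FF-translation of $\mathscr D$ is $\mathscr D^{*\downarrow}=(\mathscr D^* )^\downarrow$. ESF-translation. $\mathsf{at}(B)$ is the rightmost variable of $B\in\mathcal L^2$. Contexts $\mathtt{El}_B,\mathtt{In}_B$ use the same fresh variables: $\mathtt{El}_Z=\mathtt{In}_Z=[\ ]$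 for $Z$ a variable; $\mathtt{El}_{C\supset D}=\mathtt{El}_D[[\ ]x]$, $\mathtt{In}_{C\supset D}=\lambda x.\mathtt{In}_D$; $\mathtt{El}_{\forall X.D}=\mathtt{El}_D[[\ ]X]$, $\mathtt{In}_{\forall X.D}=\Lambda X.\mathtt{In}_D$ (if the rightmost variable is bound in $B$, $\mathsf{at}(B)$ denotes the corresponding type variable used in $\mathtt{El}_B,\mathtt{In}_B$). $(\cdot)^\sharp$ is defined on $\mathtt{NI}^\bullet$-derivations by the same clauses as $(\cdot)^*$ (with $\sharp$ in place of $*$ on terms), except that for a $\delta$-term of type $C$ with $Z=\mathsf{at}(C^* )$: $(\delta(t,y_1y_2.s_1,y_3.s_2))^\sharp=\mathtt{In}_{C^*}\{t^\sharp\,Z\,(\lambda y_1.\lambda y_2.\mathtt{El}_{C^*}[s_1^\sharp])\,(\lambda y_3.\mathtt{El}_{C^*}[s_2^\sharp])\}$. *)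

(* Defs.v *)
From Stdlib Require Import List Arith.
Import ListNotations.

(** * Formulas, with type variables as de Bruijn indices *)

Inductive form : Type :=
| FVar (n : nat)
| Imp (A B : form)
| Bul (A1 A2 A3 : form).

Inductive ty : Type :=
| TVar (n : nat)
| Arr (A B : ty)
| All (A : ty).

Definition ty_eq_dec (A B : ty) : {A = B} + {A <> B}.
Proof. decide equality; apply Nat.eq_dec. Defined.

Definition scons {T : Type} (x : T) (f : nat -> T) (n : nat) : T :=
  match n with
  | 0 => x
  | S n => f n
  end.

Definition up_ren (r : nat -> nat) : nat -> nat := scons 0 (fun n => S (r n)).

Fixpoint ty_ren (r : nat -> nat) (A : ty) : ty :=
  match A with
  | TVar n => TVar (r n)
  | Arr A B => Arr (ty_ren r A) (ty_ren r B)
  | All A => All (ty_ren (up_ren r) A)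
  end.

Fixpoint ty_subst (s : nat -> ty) (A : ty) : ty :=
  match A with
  | TVar n => s n
  | Arr A B => Arr (ty_subst s A) (ty_subst s B)
  | All A => All (ty_subst (scons (TVar 0) (fun n => ty_ren S (s n))) A)
  end.

Notation ty_shift := (ty_ren S).

Definition ty_inst (A B : ty) : ty := ty_subst (scons B TVar) A.

(** * NI^bullet: natural deduction derivations *)

Inductive NI : list form -> form -> Type :=
| Ax G x A : nth_error G x = Some A -> NI G A
| ImpI G A B : NI (A :: G) B -> NI G (Imp A B)
| ImpE G A B : NI G (Imp A B) -> NI G A -> NI G B
| BulI1 G A1 A2 A3 : NI G A1 -> NI G A2 -> NI G (Bul A1 A2 A3)
| BulI2 G A1 A2 A3 : NI G A3 -> NI G (Bul A1 A2 A3)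
| BulE G A1 A2 A3 C :
    NI G (Bul A1 A2 A3) -> NI (A2 :: A1 :: G) C -> NI (A3 :: G) C -> NI G C.

(** * NI^2: System F in Church style

    A derivation of [A] from [G] is a term [t] with [has_type G t A]: the
    context and the annotations determine the whole typing derivation. *)

Inductive term : Type :=
| Var (n : nat)
| Lam (A : ty) (t : term)
| App (t u : term)
| TLam (t : term)
| TApp (t : term) (B : ty).

Inductive has_type : list ty -> term -> ty -> Prop :=
| T_Var G x A : nth_error G x = Some A -> has_type G (Var x) A
| T_Lam G A B t : has_type (A :: G) t B -> has_type G (Lam A t) (Arr A B)
| T_App G A B t u :
    has_type G t (Arr A B) -> has_type G u A -> has_type G (App t u) B
| T_TLam G A t : has_type (map ty_shift G) t A -> has_type G (TLam t) (All A)
| T_TApp G A B t :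
    has_type G t (All A) -> has_type G (TApp t B) (ty_inst A B).

(** The type of a derivation; only meaningful on typable terms, since the
    argument of an application is not checked. *)
Fixpoint typeof (G : list ty) (t : term) : option ty :=
  match t with
  | Var x => nth_error G x
  | Lam A t => option_map (Arr A) (typeof (A :: G) t)
  | App t _ => match typeof G t with Some (Arr _ B) => Some B | _ => None end
  | TLam t => option_map All (typeof (map ty_shift G) t)
  | TApp t B =>
      match typeof G t with Some (All A) => Some (ty_inst A B) | _ => None end
  end.

(** [ren] and [subst] act simultaneously on type variables (first argument)
    and on term variables (second argument). *)
Fixpoint ren (r q : nat -> nat) (t : term) : term :=
  match t with
  | Var x => Var (q x)
  | Lam A t => Lam (ty_ren r A) (ren r (up_ren q) t)
  | App t u => App (ren r q t) (ren r q u)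
  | TLam t => TLam (ren (up_ren r) q t)
  | TApp t B => TApp (ren r q t) (ty_ren r B)
  end.

Fixpoint subst (s : nat -> ty) (p : nat -> term) (t : term) : term :=
  match t with
  | Var x => p x
  | Lam A t =>
      Lam (ty_subst s A) (subst s (scons (Var 0) (fun x => ren id S (p x))) t)
  | App t u => App (subst s p t) (subst s p u)
  | TLam t =>
      TLam (subst (scons (TVar 0) (fun n => ty_shift (s n)))
                  (fun x => ren S id (p x)) t)
  | TApp t B => TApp (subst s p t) (ty_subst s B)
  end.

Definition lift (n : nat) : term -> term := ren id (Nat.add n).
Definition tlift : term -> term := ren S id.

Definition inst (t s : term) : term := subst TVar (scons s Var) t.
Definition tinst (t : term) (B : ty) : term := subst (scons B TVar) Var t.

(** * The equivalence generated by beta, eta and epsilon *)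

Definition arrs (As : list ty) (B : ty) : ty := fold_right Arr B As.
Definition lams (As : list ty) (t : term) : term := fold_right Lam t As.
Definition apps (t : term) (us : list term) : term := fold_left App us t.

(** The universal polynomial formula whose k-th premise is
    [A_k1 -> ... -> A_km_k -> X], for [As_k = [A_k1; ...; A_km_k]] the k-th
    element of [Gs].  The [A_kj] are given outside the scope of [X], which makes
    [X] not free in them. *)
Definition upoly_premise (As : list ty) : ty := arrs (map ty_shift As) (TVar 0).
Definition upoly (Gs : list (list ty)) : ty :=
  All (arrs (map upoly_premise Gs) (TVar 0)).

(** A term context [U] is a term whose hole is the variable 0, so that
    capture-avoiding plugging [U[t]] is the substitution [inst U t].
    [eps_arg U As u] is [\w_1 ... \w_m. U[u w_1 ... w_m]]: moving under the [w]'s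
    lifts [u] and all the variables of [U] other than the hole. *)
Definition eps_arg (U : term) (As : list ty) (u : term) : term :=
  let m := length As in
  lams As
    (subst TVar
       (scons (apps (lift m u) (map Var (rev (seq 0 m)))) (fun x => Var (m + x)))
       U).

Inductive eqv : list ty -> term -> term -> ty -> Prop :=
| E_refl G t A : has_type G t A -> eqv G t t A
| E_sym G t u A : eqv G t u A -> eqv G u t A
| E_trans G t u v A : eqv G t u A -> eqv G u v A -> eqv G t v A
| E_Lam G A B t t' :
    eqv (A :: G) t t' B -> eqv G (Lam A t) (Lam A t') (Arr A B)
| E_App G A B t t' u u' :
    eqv G t t' (Arr A B) -> eqv G u u' A -> eqv G (App t u) (App t' u') B
| E_TLam G A t t' :
    eqv (map ty_shift G) t t' A -> eqv G (TLam t) (TLam t') (All A)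
| E_TApp G A B t t' :
    eqv G t t' (All A) -> eqv G (TApp t B) (TApp t' B) (ty_inst A B)
| E_beta G A B t s :
    has_type (A :: G) t B -> has_type G s A ->
    eqv G (App (Lam A t) s) (inst t s) B
| E_tbeta G A B t :
    has_type (map ty_shift G) t A ->
    eqv G (TApp (TLam t) B) (tinst t B) (ty_inst A B)
| E_eta G A B t :
    has_type G t (Arr A B) ->
    eqv G t (Lam A (App (lift 1 t) (Var 0))) (Arr A B)
| E_teta G A t :
    has_type G t (All A) ->
    eqv G t (TLam (TApp (tlift t) (TVar 0))) (All A)
| E_eps G Gs t us C D U :
    has_type G t (upoly Gs) ->
    Forall2 (fun As u => has_type G u (ty_inst (upoly_premise As) C)) Gs us ->
    has_type (C :: G) U D ->
    eqv G (inst U (apps (TApp t C) us))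
          (apps (TApp t D) (map (fun p => eps_arg U (fst p) (snd p)) (combine Gs us)))
          D.

(** * The Russell-Prawitz translation *)

Definition bullet (A B C : ty) : ty :=
  All (Arr (Arr (ty_shift A) (Arr (ty_shift B) (TVar 0)))
           (Arr (Arr (ty_shift C) (TVar 0)) (TVar 0))).

Fixpoint rp_form (A : form) : ty :=
  match A with
  | FVar n => TVar n
  | Imp A B => Arr (rp_form A) (rp_form B)
  | Bul A1 A2 A3 => bullet (rp_form A1) (rp_form A2) (rp_form A3)
  end.

(** [bullet_intro A1 A2 A3 b] is [/\X. \x1. \x2. b]; in [b], [x1] is [Var 1] and
    [x2] is [Var 0]. *)
Definition bullet_intro (A1 A2 A3 : ty) (b : term) : term :=
  TLam (Lam (Arr (ty_shift A1) (Arr (ty_shift A2) (TVar 0)))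
       (Lam (Arr (ty_shift A3) (TVar 0)) b)).

Definition bullet_in1 (A1 A2 A3 : ty) (t1 t2 : term) : term :=
  bullet_intro A1 A2 A3
    (App (App (Var 1) (lift 2 (tlift t1))) (lift 2 (tlift t2))).

Definition bullet_in2 (A1 A2 A3 : ty) (t3 : term) : term :=
  bullet_intro A1 A2 A3 (App (Var 0) (lift 2 (tlift t3))).

Definition bullet_elim (A1 A2 A3 C : ty) (t s1 s2 : term) : term :=
  App (App (TApp t C) (Lam A1 (Lam A2 s1))) (Lam A3 s2).

Fixpoint rp {G : list form} {A : form} (d : NI G A) : term :=
  match d with
  | Ax _ x _ _ => Var x
  | ImpI _ A _ d => Lam (rp_form A) (rp d)
  | ImpE _ _ _ d e => App (rp d) (rp e)
  | BulI1 _ A1 A2 A3 d1 d2 =>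
      bullet_in1 (rp_form A1) (rp_form A2) (rp_form A3) (rp d1) (rp d2)
  | BulI2 _ A1 A2 A3 d3 =>
      bullet_in2 (rp_form A1) (rp_form A2) (rp_form A3) (rp d3)
  | BulE _ A1 A2 A3 C d e1 e2 =>
      bullet_elim (rp_form A1) (rp_form A2) (rp_form A3) (rp_form C)
        (rp d) (rp e1) (rp e2)
  end.

(** * FF-atomization *)

(** [as_bullet T = Some (A, B, C)] iff [T = bullet A B C]. *)
Definition as_bullet (T : ty) : option (ty * ty * ty) :=
  match T with
  | All (Arr (Arr A (Arr B _)) (Arr (Arr C _) _)) =>
      let A := ty_ren pred A in
      let B := ty_ren pred B in
      let C := ty_ren pred C in
      if ty_eq_dec T (bullet A B C) then Some (A, B, C) else None
  | _ => None
  end.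

(** [ff_inst A B C F t] is the atomization of the instantiation at [F] of a
    derivation of [bullet A B C] whose own atomization is [t]. *)
Fixpoint ff_inst (A B C F : ty) (t : term) : term :=
  match F with
  | TVar Y => TApp t (TVar Y)
  | Arr F1 F2 =>
      (* k1 = 2, k2 = 1, m = 0 *)
      Lam (Arr A (Arr B F)) (Lam (Arr C F) (Lam F1
        (App (App (ff_inst A B C F2 (lift 3 t))
          (Lam A (Lam B (App (App (App (Var 4) (Var 1)) (Var 0)) (Var 2)))))
          (Lam C (App (App (Var 2) (Var 0)) (Var 1))))))
  | All F' =>
      (* k1 = 1, k2 = 0, Z = 0 *)
      let A' := ty_shift A in
      let B' := ty_shift B in
      let C' := ty_shift C in
      Lam (Arr A (Arr B F)) (Lam (Arr C F) (TLam
        (App (App (ff_inst A' B' C' F' (tlift (lift 2 t)))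
          (Lam A' (Lam B' (TApp (App (App (Var 3) (Var 1)) (Var 0)) (TVar 0)))))
          (Lam C' (TApp (App (Var 1) (Var 0)) (TVar 0))))))
  end.

(** On a type application outside the fragment the value is immaterial. *)
Fixpoint ff (G : list ty) (t : term) : term :=
  match t with
  | Var x => Var x
  | Lam A t => Lam A (ff (A :: G) t)
  | App t u => App (ff G t) (ff G u)
  | TLam t => TLam (ff (map ty_shift G) t)
  | TApp t F =>
      match option_map as_bullet (typeof G t) with
      | Some (Some (A, B, C)) => ff_inst A B C F (ff G t)
      | _ => TApp (ff G t) F
      end
  end.

(** * The ESF-translation

    The spine of [B] is the sequence of variables bound by [In_B].  Terms and
    types placed in the hole of [In_B] live in the ambient context extended with
    this spine. *)

Fixpoint at_var (B : ty) : nat :=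
  match B with
  | TVar Z => Z
  | Arr _ D => at_var D
  | All D => at_var D
  end.

Fixpoint In_ctx (B : ty) (t : term) : term :=
  match B with
  | TVar _ => t
  | Arr C D => Lam C (In_ctx D t)
  | All D => TLam (In_ctx D t)
  end.

(** [El_ctx k B t] is [El_B[t]] for [t] living in the ambient context extended
    with [k] term variables; the result lives in the ambient context extended
    with the spine of [B] and then with the same [k] variables, so spine
    variables are inserted below these. *)
Definition skip (k x : nat) : nat := if x <? k then x else S x.

Fixpoint El_ctx (k : nat) (B : ty) (t : term) : term :=
  match B with
  | TVar _ => t
  | Arr _ D => El_ctx k D (App (ren id (skip k) t) (Var k))
  | All D => El_ctx k D (TApp (tlift t) (TVar 0))
  end.

(** Weakening of ambient terms and types along the spine of [B]. *)
Fixpoint spine_lift (B : ty) (t : term) : term :=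
  match B with
  | TVar _ => t
  | Arr _ D => spine_lift D (lift 1 t)
  | All D => spine_lift D (tlift t)
  end.

Fixpoint spine_shift (B A : ty) : ty :=
  match B with
  | TVar _ => A
  | Arr _ D => spine_shift D A
  | All D => spine_shift D (ty_shift A)
  end.

Definition bullet_elim_esf (A1 A2 A3 C : ty) (t s1 s2 : term) : term :=
  In_ctx C
    (bullet_elim (spine_shift C A1) (spine_shift C A2) (spine_shift C A3)
       (TVar (at_var C)) (spine_lift C t) (El_ctx 2 C s1) (El_ctx 1 C s2)).

Fixpoint esf {G : list form} {A : form} (d : NI G A) : term :=
  match d with
  | Ax _ x _ _ => Var x
  | ImpI _ A _ d => Lam (rp_form A) (esf d)
  | ImpE _ _ _ d e => App (esf d) (esf e)
  | BulI1 _ A1 A2 A3 d1 d2 =>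
      bullet_in1 (rp_form A1) (rp_form A2) (rp_form A3) (esf d1) (esf d2)
  | BulI2 _ A1 A2 A3 d3 =>
      bullet_in2 (rp_form A1) (rp_form A2) (rp_form A3) (esf d3)
  | BulE _ A1 A2 A3 C d e1 e2 =>
      bullet_elim_esf (rp_form A1) (rp_form A2) (rp_form A3) (rp_form C)
        (esf d) (esf e1) (esf e2)
  end.

(* Main.v *)
Require Import Defs.
From Stdlib Require Import List.
Import ListNotations.

(** Both translations differ from the Russell-Prawitz translation only in how
    they instantiate a term [t] of type [bullet A B C], and both lower the
    instantiating formula one connective at a time.  A single step is an
    eta-expansion followed by the rule epsilon.  At an implication,

      [t (F1 -> F2) u1 u2  =  \x. (t (F1 -> F2) u1 u2) x
                           =  \x. t F2 (\a b. u1 a b x) (\c. u2 c x)],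

    where epsilon is used for the term context that applies the hole to [x]; at a
    universal formula the hole is applied to a fresh type variable instead.  These
    steps are [bullet_app_arr] and [bullet_app_all].

    For the FF-translation, [t F] is first eta-expanded to
    [\k1 k2. t F k1 k2]; induction on [F] then shows [t F] equivalent to
    [ff_inst A B C F t] ([eqv_ff_inst]).  As [ff] leaves everything else in
    place, each typable term is equivalent to its atomization
    ([eqv_ff]); in particular no restriction to a fragment of the universal
    formulas is needed.

    For the ESF-translation, [u1] and [u2] are the abstractions
    [\y1 y2. s1] and [\y3. s2], so that beta turns one step into the passage from
    [s1], [s2] to [s1 x], [s2 x], which is how [El_ctx] and [In_ctx] unfold;
    induction on the type of the elimination gives [eqv_bullet_elim_esf], and
    induction on the derivation concludes.  The latter uses congruence under the
    introductions, where the components occur weakened; by beta, [eqv] is a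
    congruence for plugging into any typed context ([eqv_inst]), so its stability
    under weakening is not required. *)

(** * Renaming and substitution *)

Lemma up_ren_ext r r' :
  (forall n, r n = r' n) -> forall n, up_ren r n = up_ren r' n.
Proof. intros H [|n]; cbn; [easy | now rewrite H]. Qed.

Lemma up_ren_id r : (forall n, r n = n) -> forall n, up_ren r n = n.
Proof. intros H [|n]; cbn; [easy | now rewrite H]. Qed.

Lemma ty_ren_ext r r' A :
  (forall n, r n = r' n) -> ty_ren r A = ty_ren r' A.
Proof.
  revert r r'; induction A as [n|A IHA B IHB|A IHA]; intros r r' H; cbn.
  - now rewrite H.
  - now rewrite (IHA r r'), (IHB r r').
  - now rewrite (IHA _ _ (up_ren_ext _ _ H)).
Qed.

Lemma ty_ren_id r A : (forall n, r n = n) -> ty_ren r A = A.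
Proof.
  revert r; induction A as [n|A IHA B IHB|A IHA]; intros r H; cbn.
  - now rewrite H.
  - now rewrite (IHA r), (IHB r).
  - now rewrite (IHA _ (up_ren_id _ H)).
Qed.

Lemma ty_ren_ren r r' A :
  ty_ren r' (ty_ren r A) = ty_ren (fun n => r' (r n)) A.
Proof.
  revert r r'; induction A as [n|A IHA B IHB|A IHA]; intros r r'; cbn.
  - easy.
  - now rewrite IHA, IHB.
  - rewrite IHA; f_equal; apply ty_ren_ext; now intros [|n].
Qed.

Lemma ty_ren_up_shift r A :
  ty_ren (up_ren r) (ty_shift A) = ty_shift (ty_ren r A).
Proof. now rewrite !ty_ren_ren. Qed.

Lemma ty_subst_ext s s' A :
  (forall n, s n = s' n) -> ty_subst s A = ty_subst s' A.
Proof.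
  revert s s'; induction A as [n|A IHA B IHB|A IHA]; intros s s' H; cbn.
  - apply H.
  - now rewrite (IHA s s'), (IHB s s').
  - f_equal; apply IHA; intros [|n]; cbn; [easy | now rewrite H].
Qed.

Lemma ty_subst_ren s r A :
  ty_subst s (ty_ren r A) = ty_subst (fun n => s (r n)) A.
Proof.
  revert s r; induction A as [n|A IHA B IHB|A IHA]; intros s r; cbn.
  - easy.
  - now rewrite IHA, IHB.
  - rewrite IHA; f_equal; apply ty_subst_ext; now intros [|n].
Qed.

Lemma ty_ren_subst s r A :
  ty_ren r (ty_subst s A) = ty_subst (fun n => ty_ren r (s n)) A.
Proof.
  revert s r; induction A as [n|A IHA B IHB|A IHA]; intros s r; cbn.
  - easy.
  - now rewrite IHA, IHB.
  - rewrite IHA; f_equal; apply ty_subst_ext; intros [|n]; cbn;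
      [easy | apply ty_ren_up_shift].
Qed.

Lemma ty_subst_TVar s r A :
  (forall n, s n = TVar (r n)) -> ty_subst s A = ty_ren r A.
Proof.
  revert s r; induction A as [n|A IHA B IHB|A IHA]; intros s r H; cbn.
  - apply H.
  - now rewrite (IHA s r), (IHB s r).
  - f_equal; apply IHA; intros [|n]; cbn; [easy | now rewrite H].
Qed.

Lemma ty_subst_id s A : (forall n, s n = TVar n) -> ty_subst s A = A.
Proof.
  intros H; rewrite (ty_subst_TVar s id A H); now apply ty_ren_id.
Qed.

Lemma ty_inst_shift A B : ty_inst (ty_shift A) B = A.
Proof. unfold ty_inst; rewrite ty_subst_ren; now apply ty_subst_id. Qed.

Lemma ty_inst_up_shift A : ty_inst (ty_ren (up_ren S) A) (TVar 0) = A.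
Proof.
  unfold ty_inst; rewrite ty_subst_ren; apply ty_subst_id; now intros [|n].
Qed.

Lemma ty_ren_inst r A B :
  ty_ren r (ty_inst A B) = ty_inst (ty_ren (up_ren r) A) (ty_ren r B).
Proof.
  unfold ty_inst; rewrite ty_ren_subst, ty_subst_ren.
  apply ty_subst_ext; now intros [|n].
Qed.

Lemma ren_ext r r' q q' t :
  (forall n, r n = r' n) -> (forall n, q n = q' n) -> ren r q t = ren r' q' t.
Proof.
  revert r r' q q'; induction t; intros r r' q q' Hr Hq; cbn; f_equal;
    auto using ty_ren_ext, up_ren_ext.
Qed.

Lemma ren_id r q t :
  (forall n, r n = n) -> (forall n, q n = n) -> ren r q t = t.
Proof.
  revert r q; induction t; intros r q Hr Hq; cbn; f_equal;
    auto using ty_ren_id, up_ren_id.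
Qed.

Lemma ren_ren r r' q q' t :
  ren r' q' (ren r q t) = ren (fun n => r' (r n)) (fun n => q' (q n)) t.
Proof.
  revert r r' q q'; induction t; intros r r' q q'; cbn; f_equal;
    rewrite ?ty_ren_ren; auto.
  - rewrite IHt; apply ren_ext; [easy | now intros [|n]].
  - rewrite IHt; apply ren_ext; [now intros [|n] | easy].
Qed.

Lemma lift_lift m n t : lift m (lift n t) = lift (m + n) t.
Proof.
  unfold lift; rewrite ren_ren; apply ren_ext; [easy|].
  intros x; apply PeanoNat.Nat.add_assoc.
Qed.

Lemma subst_ext s s' p p' t :
  (forall n, s n = s' n) -> (forall n, p n = p' n) ->
  subst s p t = subst s' p' t.
Proof.
  revert s s' p p'; induction t; intros s s' p p' Hs Hp; cbn; f_equal;
    auto using ty_subst_ext.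
  - apply IHt; [easy | intros [|x]; cbn; [easy | now rewrite Hp]].
  - apply IHt; [intros [|x]; cbn; [easy | now rewrite Hs]|].
    intros x; now rewrite Hp.
Qed.

Lemma subst_ren s p r q t :
  subst s p (ren r q t) = subst (fun n => s (r n)) (fun n => p (q n)) t.
Proof.
  revert s p r q; induction t; intros s p r q; cbn; f_equal;
    rewrite ?ty_subst_ren; auto.
  - rewrite IHt; apply subst_ext; [easy | now intros [|x]].
  - rewrite IHt; apply subst_ext; [now intros [|x] | easy].
Qed.

Lemma subst_Var s p r q t :
  (forall n, s n = TVar (r n)) -> (forall n, p n = Var (q n)) ->
  subst s p t = ren r q t.
Proof.
  revert s p r q; induction t; intros s p r q Hs Hp; cbn; rewrite ?Hp; f_equal;
    auto using ty_subst_TVar.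
  - apply IHt; [easy | intros [|x]; cbn; [easy | now rewrite Hp]].
  - apply IHt; [intros [|x]; cbn; [easy | now rewrite Hs]|].
    intros x; now rewrite Hp.
Qed.

Lemma inst_Var t k : inst t (Var k) = ren id (scons k id) t.
Proof. apply subst_Var; [easy | now intros [|x]]. Qed.

(** * Typing *)

(** [r] and [q] together form a renaming from the context [G] to [H]. *)
Definition ctx_ren (r q : nat -> nat) (G H : list ty) : Prop :=
  forall x B, nth_error G x = Some B -> nth_error H (q x) = Some (ty_ren r B).

Lemma ctx_ren_up r q G H A :
  ctx_ren r q G H -> ctx_ren r (up_ren q) (A :: G) (ty_ren r A :: H).
Proof.
  intros Hq [|x] B; cbn; [now intros [= <-] | apply Hq].
Qed.

Lemma ctx_ren_shift r q G H :
  ctx_ren r q G H -> ctx_ren (up_ren r) q (map ty_shift G) (map ty_shift H).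
Proof.
  intros Hq x B; rewrite !nth_error_map.
  destruct (nth_error G x) as [B0|] eqn:E; [|easy].
  intros [= <-]; rewrite (Hq _ _ E), ty_ren_up_shift; reflexivity.
Qed.

Lemma has_type_ren r q G H t A :
  has_type G t A -> ctx_ren r q G H -> has_type H (ren r q t) (ty_ren r A).
Proof.
  intros Ht; revert r q H; induction Ht; intros r q K Hq; cbn in *.
  - constructor; auto.
  - constructor; auto using ctx_ren_up.
  - econstructor; auto.
  - constructor; auto using ctx_ren_shift.
  - rewrite ty_ren_inst; constructor; auto.
Qed.

(** The same, for renamings that fix all type variables. *)
Lemma has_type_ren_id q G H t A :
  has_type G t A ->
  (forall x B, nth_error G x = Some B -> nth_error H (q x) = Some B) ->
  has_type H (ren id q t) A.
Proof.
  intros Ht Hq; rewrite <- (ty_ren_id id A) by easy.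
  apply has_type_ren with G; [easy|].
  intros x B E; rewrite ty_ren_id by easy; auto.
Qed.

Lemma has_type_lift H G t A :
  has_type G t A -> has_type (H ++ G) (lift (length H) t) A.
Proof.
  intros Ht; apply has_type_ren_id with G; [easy|].
  intros x B E; now rewrite nth_error_app2, PeanoNat.Nat.add_comm,
    PeanoNat.Nat.add_sub by apply PeanoNat.Nat.le_add_r.
Qed.

Lemma has_type_tlift G t A :
  has_type G t A -> has_type (map ty_shift G) (tlift t) (ty_shift A).
Proof.
  intros Ht; apply has_type_ren with G; [easy|].
  intros x B E; unfold id; rewrite nth_error_map, E; reflexivity.
Qed.

Lemma has_type_typeof G t A : has_type G t A -> typeof G t = Some A.
Proof.
  induction 1; cbn; try easy.
  - now rewrite IHhas_type.
  - now rewrite IHhas_type1.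
  - now rewrite IHhas_type.
  - now rewrite IHhas_type.
Qed.

Lemma ty_inst_upoly_premise As F : ty_inst (upoly_premise As) F = arrs As F.
Proof.
  induction As as [|A As IH]; [reflexivity|].
  exact (f_equal2 Arr (ty_inst_shift A F) IH).
Qed.

Lemma ty_inst_bullet_body A B C F :
  ty_inst (Arr (Arr (ty_shift A) (Arr (ty_shift B) (TVar 0)))
               (Arr (Arr (ty_shift C) (TVar 0)) (TVar 0))) F
  = Arr (Arr A (Arr B F)) (Arr (Arr C F) F).
Proof.
  exact (f_equal2 (fun P Q => Arr P (Arr Q F)) (ty_inst_upoly_premise [A; B] F)
           (ty_inst_upoly_premise [C] F)).
Qed.

Lemma has_type_bullet_inst G A B C F t :
  has_type G t (bullet A B C) ->
  has_type G (TApp t F) (Arr (Arr A (Arr B F)) (Arr (Arr C F) F)).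
Proof. intros Ht; rewrite <- ty_inst_bullet_body; now constructor. Qed.

Lemma eqv_bullet_inst G A B C F t t' :
  eqv G t t' (bullet A B C) ->
  eqv G (TApp t F) (TApp t' F) (Arr (Arr A (Arr B F)) (Arr (Arr C F) F)).
Proof. intros Ht; rewrite <- ty_inst_bullet_body; now constructor. Qed.

Lemma ty_shift_bullet A B C :
  ty_shift (bullet A B C) = bullet (ty_shift A) (ty_shift B) (ty_shift C).
Proof. unfold bullet; cbn; now rewrite !ty_ren_up_shift. Qed.

Lemma as_bullet_sound T A B C : as_bullet T = Some (A, B, C) -> T = bullet A B C.
Proof.
  unfold as_bullet; intros E.
  repeat match type of E with
  | match ?x with _ => _ end = _ => destruct x; try discriminate E
  end.
  injection E as <- <- <-; assumption.
Qed.

Lemma has_type_bullet_in1 G A1 A2 A3 t1 t2 :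
  has_type G t1 A1 -> has_type G t2 A2 ->
  has_type G (bullet_in1 A1 A2 A3 t1 t2) (bullet A1 A2 A3).
Proof.
  intros H1 H2; repeat econstructor;
    apply (has_type_lift [_; _]); now apply has_type_tlift.
Qed.

Lemma has_type_bullet_in2 G A1 A2 A3 t3 :
  has_type G t3 A3 -> has_type G (bullet_in2 A1 A2 A3 t3) (bullet A1 A2 A3).
Proof.
  intros H3; repeat econstructor;
    apply (has_type_lift [_; _]); now apply has_type_tlift.
Qed.

Lemma has_type_bullet_elim G A1 A2 A3 C t s1 s2 :
  has_type G t (bullet A1 A2 A3) ->
  has_type (A2 :: A1 :: G) s1 C -> has_type (A3 :: G) s2 C ->
  has_type G (bullet_elim A1 A2 A3 C t s1 s2) C.
Proof.
  intros Ht H1 H2; unfold bullet_elim.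
  econstructor; [econstructor; [apply has_type_bullet_inst; eassumption|]|];
    repeat constructor; assumption.
Qed.

Lemma has_type_rp G A (d : NI G A) :
  has_type (map rp_form G) (rp d) (rp_form A).
Proof.
  induction d; cbn in *.
  - constructor; now rewrite nth_error_map, e.
  - now constructor.
  - econstructor; eassumption.
  - now apply has_type_bullet_in1.
  - now apply has_type_bullet_in2.
  - now apply has_type_bullet_elim.
Qed.

(** * Congruence of the equivalence under the bullet constructors *)

(** Both sides are beta-reducts of one and the same abstraction, applied to [t]
    and to [t']. *)
Lemma eqv_inst G U A B t t' :
  has_type (A :: G) U B -> has_type G t A -> has_type G t' A ->
  eqv G t t' A -> eqv G (inst U t) (inst U t') B.
Proof.
  intros HU Ht Ht' E.
  eapply E_trans; [apply E_sym, E_beta; eassumption|].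
  eapply E_trans; [|apply E_beta; eassumption].
  eapply E_App; [apply E_refl; now constructor | exact E].
Qed.

Lemma ty_subst_up_TVar A :
  ty_subst (scons (TVar 0) (fun n => ty_shift (TVar n))) (ty_shift A) =
  ty_shift A.
Proof. apply ty_subst_id; now intros [|n]. Qed.

Lemma inst_bullet_in1_l A1 A2 A3 t1 t2 :
  inst (bullet_in1 A1 A2 A3 (Var 0) (lift 1 t2)) t1 =
  bullet_in1 A1 A2 A3 t1 t2.
Proof.
  unfold inst, bullet_in1, bullet_intro, lift, tlift; cbn.
  rewrite !ty_subst_up_TVar; do 4 f_equal; [f_equal|].
  - rewrite !ren_ren; apply ren_ext; reflexivity.
  - rewrite !ren_ren, subst_ren; apply subst_Var; reflexivity.
Qed.

Lemma inst_bullet_in1_r A1 A2 A3 t1 t2 :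
  inst (bullet_in1 A1 A2 A3 (lift 1 t1) (Var 0)) t2 =
  bullet_in1 A1 A2 A3 t1 t2.
Proof.
  unfold inst, bullet_in1, bullet_intro, lift, tlift; cbn.
  rewrite !ty_subst_up_TVar; do 4 f_equal; [f_equal|].
  - rewrite !ren_ren, subst_ren; apply subst_Var; reflexivity.
  - rewrite !ren_ren; apply ren_ext; reflexivity.
Qed.

Lemma inst_bullet_in2 A1 A2 A3 t3 :
  inst (bullet_in2 A1 A2 A3 (Var 0)) t3 = bullet_in2 A1 A2 A3 t3.
Proof.
  unfold inst, bullet_in2, bullet_intro, lift, tlift; cbn.
  rewrite !ty_subst_up_TVar; do 4 f_equal.
  rewrite !ren_ren; apply ren_ext; reflexivity.
Qed.

Lemma eqv_bullet_in1 G A1 A2 A3 t1 t1' t2 t2' :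
  has_type G t1 A1 -> has_type G t1' A1 -> eqv G t1 t1' A1 ->
  has_type G t2 A2 -> has_type G t2' A2 -> eqv G t2 t2' A2 ->
  eqv G (bullet_in1 A1 A2 A3 t1 t2) (bullet_in1 A1 A2 A3 t1' t2')
    (bullet A1 A2 A3).
Proof.
  intros H1 H1' E1 H2 H2' E2; apply E_trans with (bullet_in1 A1 A2 A3 t1' t2).
  - rewrite <- (inst_bullet_in1_l _ _ _ t1), <- (inst_bullet_in1_l _ _ _ t1').
    apply eqv_inst with A1; try assumption.
    apply has_type_bullet_in1; [now constructor | now apply (has_type_lift [A1])].
  - rewrite <- (inst_bullet_in1_r _ _ _ _ t2), <- (inst_bullet_in1_r _ _ _ _ t2').
    apply eqv_inst with A2; try assumption.
    apply has_type_bullet_in1; [now apply (has_type_lift [A2]) | now constructor].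
Qed.

Lemma eqv_bullet_in2 G A1 A2 A3 t3 t3' :
  has_type G t3 A3 -> has_type G t3' A3 -> eqv G t3 t3' A3 ->
  eqv G (bullet_in2 A1 A2 A3 t3) (bullet_in2 A1 A2 A3 t3') (bullet A1 A2 A3).
Proof.
  intros H3 H3' E3.
  rewrite <- (inst_bullet_in2 _ _ _ t3), <- (inst_bullet_in2 _ _ _ t3').
  apply eqv_inst with A3; try assumption.
  apply has_type_bullet_in2; now constructor.
Qed.

Lemma eqv_bullet_elim G A1 A2 A3 C t t' s1 s1' s2 s2' :
  eqv G t t' (bullet A1 A2 A3) ->
  eqv (A2 :: A1 :: G) s1 s1' C -> eqv (A3 :: G) s2 s2' C ->
  eqv G (bullet_elim A1 A2 A3 C t s1 s2) (bullet_elim A1 A2 A3 C t' s1' s2') C.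
Proof.
  intros Et E1 E2; unfold bullet_elim.
  eapply E_App; [eapply E_App; [apply eqv_bullet_inst; eassumption|]|];
    repeat apply E_Lam; assumption.
Qed.

(** * Lowering the instantiating formula by one connective *)

(** An instance of epsilon whose term context applies the hole, the variable 0,
    to the variable 1 introduced by the eta-expansion. *)
Lemma bullet_app_arr G A B C F1 F2 t u1 u2 :
  has_type G t (bullet A B C) ->
  has_type G u1 (Arr A (Arr B (Arr F1 F2))) ->
  has_type G u2 (Arr C (Arr F1 F2)) ->
  eqv G (App (App (TApp t (Arr F1 F2)) u1) u2)
    (Lam F1 (App (App (TApp (lift 1 t) F2)
       (Lam A (Lam B (App (App (App (lift 3 u1) (Var 1)) (Var 0)) (Var 2)))))
       (Lam C (App (App (lift 2 u2) (Var 0)) (Var 1)))))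
    (Arr F1 F2).
Proof.
  intros Ht H1 H2.
  eapply E_trans.
  { eapply E_eta.
    econstructor; [econstructor; [apply has_type_bullet_inst; eassumption|]|]; eassumption. }
  apply E_Lam.
  change (lift 1 (App (App (TApp t (Arr F1 F2)) u1) u2)) with
    (App (App (TApp (lift 1 t) (ty_ren id (Arr F1 F2))) (lift 1 u1)) (lift 1 u2)).
  rewrite (ty_ren_id id) by easy.
  rewrite <- (lift_lift 2 1 u1 : _ = lift 3 u1),
    <- (lift_lift 1 1 u2 : _ = lift 2 u2).
  refine (E_eps (F1 :: G) [[A; B]; [C]] (lift 1 t) [lift 1 u1; lift 1 u2]
            (Arr F1 F2) F2 (App (Var 0) (Var 1)) _ _ _).
  - now apply (has_type_lift [F1]).
  - repeat constructor; rewrite ty_inst_upoly_premise; now apply (has_type_lift [F1]).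
  - repeat econstructor.
Qed.

(** The analogue for a universal formula, where the term context applies the
    hole to the type variable introduced by the eta-expansion. *)
Lemma bullet_app_all G A B C F t u1 u2 :
  has_type G t (bullet A B C) ->
  has_type G u1 (Arr A (Arr B (All F))) ->
  has_type G u2 (Arr C (All F)) ->
  eqv G (App (App (TApp t (All F)) u1) u2)
    (TLam (App (App (TApp (tlift t) F)
       (Lam (ty_shift A) (Lam (ty_shift B)
          (TApp (App (App (lift 2 (tlift u1)) (Var 1)) (Var 0)) (TVar 0)))))
       (Lam (ty_shift C) (TApp (App (lift 1 (tlift u2)) (Var 0)) (TVar 0)))))
    (All F).
Proof.
  intros Ht H1 H2.
  apply has_type_tlift in H1 as H1', H2 as H2', Ht as Ht'.
  rewrite ty_shift_bullet in Ht'.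
  eapply E_trans.
  { eapply E_teta.
    econstructor; [econstructor; [apply has_type_bullet_inst; eassumption|]|]; eassumption. }
  apply E_TLam.
  refine (E_eps _ [[ty_shift A; ty_shift B]; [ty_shift C]] (tlift t)
            [tlift u1; tlift u2] (ty_shift (All F)) F (TApp (Var 0) (TVar 0)) _ _ _).
  - assumption.
  - repeat constructor; rewrite ty_inst_upoly_premise; assumption.
  - rewrite <- (ty_inst_up_shift F) at 2; repeat constructor.
Qed.

(** * The FF-translation *)

Lemma bullet_inst_eta2 G A B C F t :
  has_type G t (bullet A B C) ->
  eqv G (TApp t F)
    (Lam (Arr A (Arr B F)) (Lam (Arr C F)
       (App (App (TApp (lift 2 t) F) (Var 1)) (Var 0))))
    (Arr (Arr A (Arr B F)) (Arr (Arr C F) F)).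
Proof.
  intros Ht; apply (has_type_bullet_inst _ _ _ _ F) in Ht as HtF.
  eapply E_trans; [apply E_eta, HtF|]; apply E_Lam.
  eapply E_trans.
  { apply E_eta; econstructor; [apply (has_type_lift [_]), HtF | now constructor]. }
  apply E_Lam; cbn.
  fold (lift 1 (lift 1 t)); rewrite lift_lift, !(ty_ren_id id) by easy.
  apply E_refl.
  econstructor; [econstructor; [|now constructor]|now constructor].
  apply has_type_bullet_inst, (has_type_lift [_; _]), Ht.
Qed.

(** The typing half serves in [eqv_ff], where this lemma is applied to a term [t]
    that is itself an atomization. *)
Lemma eqv_ff_inst F G A B C t :
  has_type G t (bullet A B C) ->
  has_type G (ff_inst A B C F t) (Arr (Arr A (Arr B F)) (Arr (Arr C F) F)) /\
  eqv G (TApp t F) (ff_inst A B C F t) (Arr (Arr A (Arr B F)) (Arr (Arr C F) F)).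
Proof.
  revert G A B C t; induction F as [Y|F1 _ F2 IH|F IH]; intros G A B C t Ht.
  - apply (has_type_bullet_inst _ _ _ _ (TVar Y)) in Ht as HtF.
    split; [exact HtF | now apply E_refl].
  - set (P := Arr A (Arr B (Arr F1 F2))); set (Q := Arr C (Arr F1 F2)).
    pose proof (has_type_lift [F1; Q; P] G t _ Ht) as Ht3.
    destruct (IH _ _ _ _ _ Ht3) as [HT HE]; cbn in HT, HE |- *.
    fold Q P; split.
    + do 3 constructor; econstructor; [econstructor; [exact HT|]|];
        repeat econstructor.
    + eapply E_trans; [apply bullet_inst_eta2, Ht|]; do 2 apply E_Lam.
      eapply E_trans.
      { apply bullet_app_arr with (A := A) (B := B) (C := C);
          [exact (has_type_lift [Q; P] G t _ Ht) | now constructor ..]. }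
      rewrite lift_lift; apply E_Lam.
      eapply E_App; [eapply E_App; [exact HE|]|]; apply E_refl;
        repeat econstructor.
  - set (P := Arr A (Arr B (All F))); set (Q := Arr C (All F)).
    pose proof (has_type_lift [Q; P] G t _ Ht) as Ht2.
    apply has_type_tlift in Ht2 as Ht2'; rewrite ty_shift_bullet in Ht2'.
    destruct (IH _ _ _ _ _ Ht2') as [HT HE]; cbn in HT, HE |- *.
    (* Instantiating the shifted [F] at the variable 0 gives back [F]. *)
    assert (Happ : forall H u, has_type H u (ty_shift (All F)) ->
              has_type H (TApp u (TVar 0)) F).
    { intros H u Hu; rewrite <- (ty_inst_up_shift F); now constructor. }
    fold Q P; split.
    + do 3 constructor; econstructor; [econstructor; [exact HT|]|];
        repeat constructor; apply Happ; repeat econstructor.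
    + eapply E_trans; [apply bullet_inst_eta2, Ht|]; do 2 apply E_Lam.
      eapply E_trans.
      { apply bullet_app_all with (A := A) (B := B) (C := C);
          [exact Ht2 | now constructor ..]. }
      apply E_TLam.
      eapply E_App; [eapply E_App; [exact HE|]|]; apply E_refl;
        repeat constructor; apply Happ; repeat econstructor.
Qed.

Lemma eqv_ff G t A :
  has_type G t A -> has_type G (ff G t) A /\ eqv G t (ff G t) A.
Proof.
  induction 1 as [G x A Hx|G A B t Ht [HT HE]|G A B t u Ht [HT HE] Hu [HU HF]
                 |G A t Ht [HT HE]|G A F t Ht [HT HE]]; cbn.
  - now split; [|apply E_refl]; constructor.
  - now split; constructor.
  - now split; econstructor; eauto.
  - now split; constructor.
  - rewrite (has_type_typeof _ _ _ Ht); cbn [option_map].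
    destruct (as_bullet (All A)) as [[[A1 A2] A3]|] eqn:E.
    + apply as_bullet_sound in E; injection E as ->.
      rewrite ty_inst_bullet_body.
      destruct (eqv_ff_inst F _ _ _ _ _ HT) as [HT' HE'].
      split; [exact HT'|].
      eapply E_trans; [apply eqv_bullet_inst, HE | exact HE'].
    + now split; constructor.
Qed.

(** * The ESF-translation *)

(** An abstraction weakened by the variables that it binds and applied to them
    is its own body: two beta-steps undo the renaming. *)
Lemma eqv_beta2_lift G A1 A2 T s :
  has_type (A2 :: A1 :: G) s T ->
  eqv (A2 :: A1 :: G)
    (App (App (lift 2 (Lam A1 (Lam A2 s))) (Var 1)) (Var 0)) s T.
Proof.
  intros Hs.
  assert (H : has_type (A2 :: A1 :: G) (lift 2 (Lam A1 (Lam A2 s)))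
                (Arr A1 (Arr A2 T))).
  { apply (has_type_lift [A2; A1]); now repeat constructor. }
  cbn in H |- *; rewrite !(ty_ren_id id) in * by easy.
  inversion_clear H as [|? ? ? ? H'| | |].
  eapply E_trans.
  { eapply E_App; [|now apply E_refl, T_Var with (A := A2)].
    apply E_beta; [exact H' | now constructor]. }
  rewrite inst_Var; cbn; rewrite !(ty_ren_id id) by easy.
  inversion_clear H' as [|? ? ? ? H''| | |].
  eapply E_trans.
  { apply E_beta; [|now constructor].
    apply has_type_ren_id with (1 := H'').
    intros [|[|[|x]]] D; cbn; easy. }
  rewrite inst_Var, !ren_ren, ren_id; [now apply E_refl | easy|].
  now intros [|[|x]].
Qed.

Lemma eqv_beta_lift G A T s :
  has_type (A :: G) s T ->
  eqv (A :: G) (App (lift 1 (Lam A s)) (Var 0)) s T.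
Proof.
  intros Hs.
  assert (H : has_type (A :: G) (lift 1 (Lam A s)) (Arr A T)).
  { apply (has_type_lift [A]); now constructor. }
  cbn in H |- *; rewrite !(ty_ren_id id) in * by easy.
  inversion_clear H as [|? ? ? ? H'| | |].
  eapply E_trans; [apply E_beta; [exact H' | now constructor]|].
  rewrite inst_Var, !ren_ren, ren_id; [now apply E_refl | easy|].
  now intros [|x].
Qed.

Lemma eqv_bullet_elim_arr G A1 A2 A3 C D t s1 s2 :
  has_type G t (bullet A1 A2 A3) ->
  has_type (A2 :: A1 :: G) s1 (Arr C D) -> has_type (A3 :: G) s2 (Arr C D) ->
  eqv G (bullet_elim A1 A2 A3 (Arr C D) t s1 s2)
    (Lam C (bullet_elim A1 A2 A3 D (lift 1 t)
       (App (ren id (skip 2) s1) (Var 2)) (App (ren id (skip 1) s2) (Var 1))))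
    (Arr C D).
Proof.
  intros Ht H1 H2.
  assert (H1' : has_type (A2 :: A1 :: C :: G) (ren id (skip 2) s1) (Arr C D)).
  { apply has_type_ren_id with (1 := H1); now intros [|[|x]]. }
  assert (H2' : has_type (A3 :: C :: G) (ren id (skip 1) s2) (Arr C D)).
  { apply has_type_ren_id with (1 := H2); now intros [|x]. }
  eapply E_trans.
  { apply bullet_app_arr with (A := A1) (B := A2) (C := A3);
      [exact Ht | now repeat constructor ..]. }
  apply E_Lam.
  rewrite <- (lift_lift 2 1 (Lam A1 _) : _ = lift 3 _),
    <- (lift_lift 1 1 (Lam A3 _) : _ = lift 2 _).
  replace (lift 1 (Lam A1 (Lam A2 s1))) with
    (Lam A1 (Lam A2 (ren id (skip 2) s1))).
  2:{ cbn; rewrite !(ty_ren_id id) by easy; do 2 f_equal.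
      apply ren_ext; [easy | now intros [|[|x]]]. }
  replace (lift 1 (Lam A3 s2)) with (Lam A3 (ren id (skip 1) s2)).
  2:{ cbn; rewrite !(ty_ren_id id) by easy; f_equal.
      apply ren_ext; [easy | now intros [|x]]. }
  eapply E_App; [eapply E_App|].
  - apply E_refl, has_type_bullet_inst, (has_type_lift [C]), Ht.
  - do 2 apply E_Lam; eapply E_App; [apply eqv_beta2_lift, H1'|].
    now apply E_refl, T_Var.
  - apply E_Lam; eapply E_App; [apply eqv_beta_lift, H2'|].
    now apply E_refl, T_Var.
Qed.

Lemma eqv_bullet_elim_all G A1 A2 A3 D t s1 s2 :
  has_type G t (bullet A1 A2 A3) ->
  has_type (A2 :: A1 :: G) s1 (All D) -> has_type (A3 :: G) s2 (All D) ->
  eqv G (bullet_elim A1 A2 A3 (All D) t s1 s2)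
    (TLam (bullet_elim (ty_shift A1) (ty_shift A2) (ty_shift A3) D (tlift t)
       (TApp (tlift s1) (TVar 0)) (TApp (tlift s2) (TVar 0))))
    (All D).
Proof.
  intros Ht H1 H2.
  apply has_type_tlift in H1 as H1', H2 as H2', Ht as Ht'.
  rewrite ty_shift_bullet in Ht'.
  eapply E_trans.
  { apply bullet_app_all with (A := A1) (B := A2) (C := A3);
      [exact Ht | now repeat constructor ..]. }
  apply E_TLam.
  replace (tlift (Lam A1 (Lam A2 s1))) with
    (Lam (ty_shift A1) (Lam (ty_shift A2) (tlift s1))).
  2:{ cbn; do 2 f_equal; apply ren_ext; [easy | now intros [|[|x]]]. }
  replace (tlift (Lam A3 s2)) with (Lam (ty_shift A3) (tlift s2)).
  2:{ cbn; f_equal; apply ren_ext; [easy | now intros [|x]]. }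
  eapply E_App; [eapply E_App|].
  - apply E_refl, has_type_bullet_inst, Ht'.
  - do 2 apply E_Lam; rewrite <- (ty_inst_up_shift D).
    apply E_TApp, eqv_beta2_lift, H1'.
  - apply E_Lam; rewrite <- (ty_inst_up_shift D).
    apply E_TApp, eqv_beta_lift, H2'.
Qed.

Lemma eqv_bullet_elim_esf C G A1 A2 A3 t s1 s2 :
  has_type G t (bullet A1 A2 A3) ->
  has_type (A2 :: A1 :: G) s1 C -> has_type (A3 :: G) s2 C ->
  has_type G (bullet_elim_esf A1 A2 A3 C t s1 s2) C /\
  eqv G (bullet_elim A1 A2 A3 C t s1 s2)
    (bullet_elim_esf A1 A2 A3 C t s1 s2) C.
Proof.
  revert G A1 A2 A3 t s1 s2.
  induction C as [Z|C _ D IH|D IH]; intros G A1 A2 A3 t s1 s2 Ht H1 H2.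
  - pose proof (has_type_bullet_elim _ _ _ _ _ _ _ _ Ht H1 H2) as H.
    split; [exact H | now apply E_refl].
  - edestruct (IH (C :: G)) as [HT HE]; cycle 3.
    + split; [apply T_Lam, HT|].
      eapply E_trans; [now apply eqv_bullet_elim_arr | apply E_Lam, HE].
    + now apply (has_type_lift [C]).
    + econstructor; [|now constructor].
      apply has_type_ren_id with (1 := H1); now intros [|[|x]].
    + econstructor; [|now constructor].
      apply has_type_ren_id with (1 := H2); now intros [|x].
  - edestruct (IH (map ty_shift G)) as [HT HE]; cycle 3.
    + split; [apply T_TLam, HT|].
      eapply E_trans; [now apply eqv_bullet_elim_all | apply E_TLam, HE].
    + rewrite <- ty_shift_bullet; now apply has_type_tlift.
    + rewrite <- (ty_inst_up_shift D); constructor.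
      apply (has_type_tlift _ _ _ H1).
    + rewrite <- (ty_inst_up_shift D); constructor.
      apply (has_type_tlift _ _ _ H2).
Qed.

Lemma eqv_esf G A (d : NI G A) :
  has_type (map rp_form G) (esf d) (rp_form A) /\
  eqv (map rp_form G) (rp d) (esf d) (rp_form A).
Proof.
  induction d as [G x A Hx|G A B d [HT HE]|G A B d [HT HE] e [HU HF]
    |G A1 A2 A3 d1 [H1 E1] d2 [H2 E2]|G A1 A2 A3 d3 [H3 E3]
    |G A1 A2 A3 C d [HT HE] e1 [H1 E1] e2 [H2 E2]]; cbn in *.
  - assert (H : has_type (map rp_form G) (Var x) (rp_form A))
      by (constructor; now rewrite nth_error_map, Hx).
    split; [exact H | now apply E_refl].
  - now split; constructor.
  - split; econstructor; eassumption.
  - split; [now apply has_type_bullet_in1|].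
    apply eqv_bullet_in1; auto using has_type_rp.
  - split; [now apply has_type_bullet_in2|].
    apply eqv_bullet_in2; auto using has_type_rp.
  - destruct (eqv_bullet_elim_esf (rp_form C) _ _ _ _ _ _ _ HT H1 H2) as [H E].
    split; [exact H|].
    eapply E_trans; [apply eqv_bullet_elim; eassumption | exact E].
Qed.

Theorem corollary4p8 (G : list form) (A : form) (d : NI G A) :
  eqv (map rp_form G) (rp d) (ff (map rp_form G) (rp d)) (rp_form A) /\
  eqv (map rp_form G) (rp d) (esf d) (rp_form A).
Proof. split; [apply eqv_ff, has_type_rp | apply eqv_esf]. Qed.
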